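(* Let $m\ge1$ and $N\ge1$ be integers. The $N$-colored Jones polynomial of the torus knot $\mathcal{T}_{2,2m+1}$ is given by $$J_{\mathcal{T}_{2,2m+1}}(N)=q^{m(1-N)}\sum_{k_m\ge\dots\ge k_2\ge k_1\ge0}(q^{1-N})_{k_m}\,q^{-Nk_m}\left(\prod_{i=1}^{m-1}q^{k_i(k_i+1-2N)}\begin{bmatrix} k_{i+1} \\ k_i \end{bmatrix}_q\right),$$ where the sum is over all integers $k_1,\dots,k_m$ with $k_m\ge\dots\ge k_1\ge0$ (only finitely many terms are nonzero, since $(q^{1-N})_{k}=0$ for $k\ge N$).
   Context: Notation: $(x)_n=(x;q)_n=\prod_{k=1}^n(1-xq^{k-1})$ and $\begin{bmatrix} n \\ m \end{bmatrix}_q=\frac{(q)_n}{(q)_{n-m}(q)_m}$. For a knot $\mathcal{K}$ and an integer $N\ge1$, $J_{\mathcal{K}}(N)\in\mathbb{Z}[q,q^{-1}]$ denotes the $N$-colored Jones polynomial (associated with the $N$-dimensional irreducible representation of $sl(2)$), in the indeterminate $q$, normalized so that $J_{\text{unknot}}(N)=1$. $\mathcal{T}_{s,t}$ is the $(s,t)$ torus knot, for relatively prime $s,t$. The conventions for $q$ and chirality are those for which the following known formula of Morton holds (it may be taken as the definition): $$J_{\mathcal{T}_{s,t}}(N)=\frac{q^{\frac14 st(1-N^2)}}{q^{N/2}-q^{-N/2}}\sum_{r=-\frac{N-1}{2}}^{\frac{N-1}{2}}\left(q^{str^2-(s+t)r+\frac12}-q^{str^2-(s-t)r-\frac12}\right),$$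 where $r$ runs in steps of $1$ from $-\frac{N-1}{2}$ to $\frac{N-1}{2}$. *)

(* Defs.v *)
From HB Require Import structures.
From mathcomp Require Import all_boot all_order all_algebra.
From mathcomp Require Import classical_sets cardinality fsbigop.

Set Implicit Arguments.
Unset Strict Implicit.
Unset Printing Implicit Defensive.

Import Order.TTheory GRing.Theory Num.Theory.
Local Open Scope ring_scope.

(* The formulas involve powers of q with exponents in (1/4)Z, so the ambient  *)
(* field is the field of rational functions in an indeterminate u = q^(1/4).  *)
Definition K : fieldType := {fraction {poly int}}.

Definition u : K := FracField.tofrac 'X.

Definition q : K := u ^+ 4.

Definition qpoch (x : K) (n : nat) : K :=
  \prod_(1 <= k < n.+1) (1 - x * q ^+ k.-1).

(* The value 0 for n < m is the usual convention.                             *)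
Definition qbinom (n m : nat) : K :=
  if (m <= n)%N then qpoch q n / (qpoch q (n - m) * qpoch q m) else 0.

(* Morton's formula for the N-colored Jones polynomial of the (s, t) torus    *)
(* knot, normalized to 1 on the unknot.  It is meaningful for coprime s, t.   *)
(* A power q^a is written u ^ (4 * a), and d stands for 2 * r, which runs     *)
(* over -(N - 1), -(N - 1) + 2, ..., N - 1 for j = 0, ..., N - 1.             *)
Definition jones_torus (s t N : nat) : K :=
  let s' := s%:Z in let t' := t%:Z in let N' := N%:Z in
  u ^ (s' * t' * (1 - N' ^+ 2)) / (u ^ (2 * N') - u ^ (- (2 * N'))) *
  \sum_(j < N)
     let d : int := 2 * (j : nat)%:Z - (N' - 1) in
     (u ^ (s' * t' * d ^+ 2 - 2 * (s' + t') * d + 2)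
      - u ^ (s' * t' * d ^+ 2 - 2 * (s' - t') * d - 2)).

(* The index k_i, 1 <= i <= m, is the entry of rank i - 1 of the tuple.       *)
Definition idx (m : nat) (k : m.-tuple nat) (i : nat) : nat := nth 0%N k i.-1.

Definition jones_term (m N : nat) (k : m.-tuple nat) : K :=
  qpoch (q ^ (1 - N%:Z)) (idx k m) * q ^ (- (N%:Z * (idx k m)%:Z)) *
  \prod_(1 <= i < m)
     (q ^ ((idx k i)%:Z * ((idx k i)%:Z + 1 - 2 * N%:Z))
      * qbinom (idx k i.+1) (idx k i)).

(* Main.v *)
Require Import Defs.
From mathcomp Require Import all_boot all_order all_algebra.
From mathcomp Require Import classical_sets cardinality fsbigop.
From mathcomp Require Import ring.

Set Implicit Arguments.
Unset Strict Implicit.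
Unset Printing Implicit Defensive.

Import Order.TTheory GRing.Theory Num.Theory.
Local Open Scope ring_scope.

(* The nested sum is a finite Bailey chain relative to a = q^(1-2N): from the
   unit Bailey pair (beta_n = delta_(n,0)), one Bailey step gives
   beta_n = 1/(q)_n, and each of the m - 1 sums over k_1, ..., k_(m-1) is one
   more step; a step multiplies alpha_r by a^r q^(r^2).  The outer sum over k_m,
   with weight (q^(1-N))_k q^(-Nk), is a terminating q-Chu-Vandermonde sum, and
   leaves an alternating sum over 0 <= r < N.  Morton's sum for s = 2 is the
   same one: up to a factor its two halves combine into values at N integers e
   of a function odd about 1/2, and folding these at 1/2 produces the sign
   (-1)^r. *)

(** * Finite q-series: Pochhammer symbols, Gaussian binomials, q-Vandermonde *)

Section QSeries.

Context (F : fieldType) (q : F).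

(* Over K these are qpoch and qbinom up to conversion; an abstract field keeps
   unification from unfolding q = u ^+ 4. *)
Definition poch (x : F) (n : nat) : F :=
  \prod_(1 <= k < n.+1) (1 - x * q ^+ k.-1).

Definition gauss (n m : nat) : F :=
  if (m <= n)%N then poch q n / (poch q (n - m) * poch q m) else 0.

Lemma poch0 x : poch x 0 = 1.
Proof. by rewrite /poch big_geq. Qed.

Lemma pochS x n : poch x n.+1 = poch x n * (1 - x * q ^+ n).
Proof. by rewrite /poch big_nat_recr. Qed.

Lemma pochD x m n : poch x (m + n) = poch x m * poch (x * q ^+ m) n.
Proof.
elim: n => [|n IHn]; first by rewrite addn0 poch0 mulr1.
by rewrite addnS !pochS IHn exprD !mulrA.
Qed.

Lemma pochSl x n : poch x n.+1 = (1 - x) * poch (x * q) n.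
Proof. by rewrite -add1n pochD pochS poch0 expr0 mulr1 mul1r. Qed.

Lemma poch_neq0 x n :
  (forall k, (k < n)%N -> x * q ^+ k != 1) -> poch x n != 0.
Proof.
elim: n => [|n IHn] xP; first by rewrite poch0 oner_neq0.
rewrite pochS mulf_neq0 //; first by apply: IHn => k kn; rewrite xP // ltnW.
by rewrite subr_eq0 eq_sym xP.
Qed.

Hypothesis qP : forall n, (0 < n)%N -> q ^+ n != 1.

Lemma qfact_neq0 n : poch q n != 0.
Proof. by apply: poch_neq0 => k _; rewrite -exprS qP. Qed.

Lemma gauss0 n : gauss n 0 = 1.
Proof. by rewrite /gauss subn0 poch0 mulr1 divff ?qfact_neq0. Qed.

Lemma gauss_small n m : (n < m)%N -> gauss n m = 0.
Proof. by move=> nm; rewrite /gauss leqNgt nm. Qed.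

Lemma gaussS n m : (m <= n)%N ->
  gauss n.+1 m.+1 = gauss n m.+1 + q ^+ (n - m) * gauss n m.
Proof.
move=> mn; rewrite /gauss ltnS mn subSS.
have nz := qfact_neq0; have nz1 k : 1 - q * q ^+ k != 0.
  by rewrite -exprS subr_eq0 eq_sym qP.
case: (ltngtP m n) mn => // [mn|->] _; last first.
  by rewrite subnn poch0 add0r expr0 !mul1r !divff.
have [d ->] : exists d, n = (m + d.+1)%N.
  by exists (n - m.+1)%N; rewrite addnS -addSn subnKC.
rewrite addKn addnS subSS addKn !pochS !exprS exprD.
move: (nz m) (nz d) (nz1 m) (nz1 d) => {nz nz1}.
by move=> hA hB hC hD; field; rewrite hA hB hC hD.
Qed.

(** The q-Pascal rule in summed form, which drives the induction in [q_vandermonde]. *)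
Lemma sum_gaussS n (f : nat -> F) :
  \sum_(j < n.+2) gauss n.+1 j * f j =
  \sum_(j < n.+1) gauss n j * (f j + q ^+ (n - j) * f j.+1).
Proof.
rewrite big_ord_recl gauss0.
under [in LHS]eq_bigr => j _ do rewrite lift0 gaussS ?leq_ord // mulrDl.
rewrite big_split /= addrA.
under [in RHS]eq_bigr => j _ do rewrite mulrDr.
rewrite big_split /=; congr (_ + _); last first.
  by apply: eq_bigr => j _; rewrite mulrCA mulrA.
rewrite big_ord_recr /= gauss_small // mul0r addr0.
by rewrite [RHS]big_ord_recl gauss0.
Qed.

(* The usual form has (B)_j D^j, with E = B * D, in place of the inner product;
   this form also covers D = 0, which is the case needed in the Bailey chain. *)
Lemma q_vandermonde n (D E : F) :
  \sum_(j < n.+1) gauss n j *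
    ((-1) ^+ j * q ^+ 'C(j, 2) * (\prod_(i < j) (D - E * q ^+ i)) *
     poch (E * q ^+ j) (n - j)) = poch D n.
Proof.
have prodS j E' : \prod_(i < j.+1) (D - E' * q ^+ i) =
    (D - E') * \prod_(i < j) (D - E' * q * q ^+ i).
  rewrite big_ord_recl expr0 mulr1; congr (_ * _).
  by apply: eq_bigr => i _; rewrite lift0 exprS mulrA.
elim: n E => [|n IHn] E.
  by rewrite big_ord1 gauss0 big_ord0 !poch0 !expr0 !mulr1.
rewrite (sum_gaussS n (fun j => (-1) ^+ j * q ^+ 'C(j, 2) *
  (\prod_(i < j) (D - E * q ^+ i)) * poch (E * q ^+ j) (n.+1 - j))).
(* After the q-Pascal rule the summand is (1 - E q^n) times the summand for E, minus (D - E) q^n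
   times the one for E q. Both sums are (D)_n by induction, and the coefficients add up to 1 - D
   q^n. *)
transitivity ((1 - E * q ^+ n) * poch D n - (D - E) * q ^+ n * poch D n);
  last by rewrite pochS; ring.
rewrite -{1}(IHn E) -(IHn (E * q)) !mulr_sumr -sumrB.
apply: eq_bigr => -[j /= jn] _; rewrite ltnS in jn.
rewrite -(subnKC jn); move: (n - j)%N => d {n IHn jn}.
rewrite subSS -addnS !addKn pochS prodS binS bin1.
rewrite -(mulrA E q) -exprS !exprS !exprD.
ring.
Qed.

(** The case D = 0, E = b q: the signs cancel, and the powers of q combine because 2 C(j,2) + j =
    j^2. *)
Lemma q_vandermonde0 n (b : F) :
  \sum_(j < n.+1) gauss n j * (b ^+ j * q ^+ (j ^ 2)) *
    poch (b * q * q ^+ j) (n - j) = 1.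
Proof.
have <- : poch 0 n = 1.
  by rewrite /poch big1 // => k _; rewrite mul0r subr0.
rewrite -(q_vandermonde n 0 (b * q)); apply: eq_bigr => j _.
rewrite -mulrA; congr (_ * (_ * _)).
elim: (j : nat) => [|k IHk]; first by rewrite big_ord0 !expr0 !mulr1.
have -> : b ^+ k.+1 * q ^+ (k.+1 ^ 2) =
    (b ^+ k * q ^+ (k ^ 2)) * (b * q * q ^+ k * q ^+ k).
  by rewrite -addn1 sqrnD exp1n muln1 mul2n -addnn !exprD !expr1; ring.
by rewrite big_ord_recr /= sub0r IHk binS bin1 exprD exprS; ring.
Qed.

(** * The Bailey chain, with both parameters of Bailey's lemma sent to infinity *)

Lemma bailey_step (a : F) r n :
  (forall k, (k < r + n + r)%N -> a * q * q ^+ k != 1) ->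
  \sum_(j < n.+1) a ^+ (r + j) * q ^+ ((r + j) ^ 2) /
    (poch q (n - j) * poch q j * poch (a * q) (r + j + r)) =
  a ^+ r * q ^+ (r ^ 2) / (poch q n * poch (a * q) (r + n + r)).
Proof.
(* With b = a q^(2r), each summand on the left is the right side times a summand of
   [q_vandermonde0]: expand (r + j)^2 and split (aq)_(2r+n) at 2r and at 2r + j. *)
move=> aP; rewrite -[RHS]mulr1 -(q_vandermonde0 n (a * q ^+ (r + r))).
rewrite mulr_sumr; apply: eq_bigr => -[j /= jn] _; rewrite ltnS in jn.
have nz : poch (a * q) (r + n + r) != 0 by apply: poch_neq0.
rewrite /gauss jn; move: nz; rewrite addnAC [in (r + j + r)%N]addnAC.
rewrite -(subnKC jn) addnA addKn; move: (n - j)%N => d.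
rewrite (pochD _ (r + r + j)) (pochD _ (r + r)) !mulf_eq0 !negb_or =>
  /andP[/andP[nz1 nz2] nz3].
have -> : a * q ^+ (r + r) * q = a * q * q ^+ (r + r) by ring.
have -> : a * q * q ^+ (r + r) * q ^+ j = a * q * q ^+ (r + r + j).
  by rewrite !exprD !mulrA.
move: nz1 nz2 nz3 (qfact_neq0 j) (qfact_neq0 d) (qfact_neq0 (j + d)).
rewrite sqrnD exprMn -exprM mul2n -addnn mulnDl !exprD => *.
by field; do ![apply/andP; split].
Qed.

(** The alpha_r of the unit Bailey pair relative to a. *)
Definition unit_alpha (a : F) r : F :=
  (-1) ^+ r * q ^+ 'C(r, 2) * poch a r * (1 - a * q ^+ (r + r)) /
  (poch q r * (1 - a)).

(** With L = n + d + 1, this is a sum cut off strictly before its full range r <= L. Such partial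
    sums have a product form, so induction on n applies; it keeps L fixed and trades d for d + 1. *)
Lemma bailey_unit_partial (a : F) n d :
  a != 1 -> (forall k, (k < n + d.+1 + n)%N -> a * q * q ^+ k != 1) ->
  \sum_(r < n.+1) unit_alpha a r /
    (poch q (n + d.+1 - r) * poch (a * q) (n + d.+1 + r)) =
  (-1) ^+ n * q ^+ 'C(n.+1, 2) * poch a n.+1 /
    ((1 - a) * poch q n * poch q d * poch (a * q) (n + d.+1 + n) *
     (1 - q ^+ (n + d.+1))).
Proof.
move=> a1; have nza : 1 - a != 0 by rewrite subr_eq0 eq_sym.
elim: n d => [|n IHn] d aP.
  have nzL : 1 - q ^+ d.+1 != 0 by rewrite subr_eq0 eq_sym qP.
  have nz := poch_neq0 aP.
  rewrite big_ord1 /unit_alpha !addn0 subn0 !expr0 !poch0 pochS poch0.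
  rewrite add0n addn0 in nz; rewrite add0n (pochS q d) -exprS.
  move: nz nzL nza (qfact_neq0 d).
  by move=> *; field; do ![apply/andP; split].
rewrite big_ord_recr /= addSnnS IHn; last first.
  by move=> k kn; apply: aP; rewrite addSnnS addnS ltnW.
have nz := poch_neq0 aP; move: nz.
have nzL : 1 - q ^+ (n + d.+2) != 0 by rewrite subr_eq0 eq_sym qP // addnS.
have nzS k : 1 - q * q ^+ k != 0 by rewrite -exprS subr_eq0 eq_sym qP.
rewrite /unit_alpha -[(n + d.+2)%N]addSnnS addKn addSnnS.
rewrite addnS !pochS mulf_eq0 negb_or => /andP[nz1 nz2].
rewrite [in X in X = _]binS bin1 [in RHS]binS bin1 [in RHS]binS bin1.
move: nz1 nz2 nzL nza (qfact_neq0 d) (qfact_neq0 n) (nzS n) (nzS d).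
rewrite !(addnS, addSn) !exprS !exprD => *.
by field; do ![apply/andP; split].
Qed.

(** For positive n, [bailey_unit_partial] at d = 0 sums all terms but the last, and the last is the
    opposite of that value. *)
Lemma bailey_unit (a : F) n :
  a != 1 -> (forall k, (k < n + n)%N -> a * q * q ^+ k != 1) ->
  \sum_(r < n.+1) unit_alpha a r / (poch q (n - r) * poch (a * q) (n + r)) =
  (n == 0)%:R.
Proof.
move=> a1; case: n => [|n] aP.
  rewrite big_ord1 /unit_alpha !poch0 !expr0 mulr1 !mul1r invr1 mulr1 divff //.
  by rewrite subr_eq0 eq_sym.
have aP' k : (k < n + 1 + n)%N -> a * q * q ^+ k != 1.
  by rewrite addnAC addn1 => kn; apply: aP; rewrite addnS addSn ltnW.
have := bailey_unit_partial a1 aP'; rewrite addn1 => partialE.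
rewrite big_ord_recr /= partialE subnn.
have nzL : 1 - q ^+ n.+1 != 0 by rewrite subr_eq0 eq_sym qP.
have := poch_neq0 aP.
have nzn : 1 - q * q ^+ n != 0 by rewrite -exprS.
have nza : 1 - a != 0 by rewrite subr_eq0 eq_sym.
rewrite /unit_alpha !(addnS, addSn) poch0 (pochS q n) (pochS a n).
rewrite (pochS _ (n + n).+1) mulf_eq0 negb_or => /andP[nz1 nz2].
move: nz1 nz2 nzL nzn nza (qfact_neq0 n); rewrite !(exprS, exprD) => *.
by field; do ![apply/andP; split].
Qed.

Lemma sum_triangle (V : nmodType) n (f : nat -> nat -> V) :
  \sum_(k < n) \sum_(r < k.+1) f k r =
  \sum_(r < n) \sum_(j < n - r) f (r + j)%N r.
Proof.
elim: n => [|n IHn]; first by rewrite !big_ord0.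
rewrite !big_ord_recr /= IHn subSnn big_ord1 addn0 addrA -big_split /=.
congr (_ + _); apply: eq_bigr => r _.
by rewrite subSn ?(ltnW (ltn_ord r)) // big_ord_recr /= subnKC // ltnW.
Qed.

(** A Bailey step in the normalization f l = (q)_l beta_l. The bound N does not depend on n, so that
    the sums iterate over a fixed range; terms with l > n vanish through [gauss]. *)
Definition bailey_op (a : F) N (f : nat -> F) (n : nat) : F :=
  \sum_(l < N) a ^+ l * q ^+ (l ^ 2) * gauss n l * f l.

(** The start is the unit pair. At each further step the sums over l and r are exchanged and
    [bailey_step] evaluates the inner one; n <= N ensures that the cut-off of the operator loses no
    term. *)
Lemma bailey_chain (a : F) N i n :
  a != 1 -> (forall k, (k < N + N)%N -> a * q * q ^+ k != 1) -> (n <= N)%N ->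
  iter i (bailey_op a N.+1) (fun l => (l == 0)%:R) n =
  poch q n * \sum_(r < n.+1) unit_alpha a r * (a ^+ r * q ^+ (r ^ 2)) ^+ i /
    (poch q (n - r) * poch (a * q) (n + r)).
Proof.
move=> a1 aP; elim: i n => [|i IHi] n nN.
  under eq_bigr => r _ do rewrite expr0 mulr1.
  rewrite bailey_unit // => [|k kn]; last first.
    by apply: aP; rewrite (leq_trans kn) // leq_add.
  by case: n {nN} => [|n]; rewrite ?poch0 ?mul1r // mulr0.
rewrite iterS; move: (iter i _ _) IHi => f IHi; rewrite /bailey_op.
transitivity (poch q n * \sum_(l < n.+1) \sum_(r < l.+1)
  unit_alpha a r * (a ^+ r * q ^+ (r ^ 2)) ^+ i *
  (a ^+ l * q ^+ (l ^ 2) /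
     (poch q (n - l) * poch q (l - r) * poch (a * q) (l + r)))).
  rewrite -(subnKC nN) -addSn big_split_ord /= [X in _ + X]big1 ?addr0; last first.
    by move=> l _; rewrite gauss_small ?mulr0 ?mul0r // ltnS leq_addr.
  rewrite mulr_sumr; apply: eq_bigr => -[l /= ln] _; rewrite ltnS in ln.
  rewrite IHi ?(leq_trans ln nN) // /gauss ln !mulr_sumr; apply: eq_bigr => r _.
  have nz : poch (a * q) (l + r) != 0.
    apply: poch_neq0 => k kl; apply: aP; apply: (leq_trans kl).
    have lN : (l <= N)%N := leq_trans ln nN.
    by rewrite leq_add // (leq_trans _ lN) // -ltnS.
  by field; rewrite nz !qfact_neq0.
congr (_ * _); rewrite (sum_triangle _ (fun l r =>
  unit_alpha a r * (a ^+ r * q ^+ (r ^ 2)) ^+ i *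
  (a ^+ l * q ^+ (l ^ 2) /
     (poch q (n - l) * poch q (l - r) * poch (a * q) (l + r))))).
apply: eq_bigr => -[r /= rn] _; rewrite ltnS in rn.
rewrite -mulr_sumr exprSr subSn //.
under eq_bigr => j _ do rewrite subnDA addKn.
rewrite bailey_step ?subnKC // => [|k kn]; first by rewrite !mulrA.
by apply: aP; rewrite (leq_trans kn) // leq_add // (leq_trans rn).
Qed.

(** * Summation over the outer index *)

Lemma mul_exp_neq1 (y : F) n k : y * q ^+ n = 1 -> (k < n)%N -> y * q ^+ k != 1.
Proof.
move=> yn kn; have := @qP (n - k); rewrite subn_gt0 => /(_ kn).
apply: contra => /eqP yk; apply/eqP.
by rewrite -[LHS]mul1r -[X in X * _]yk -mulrA -exprD subnKC // ltnW.
Qed.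

(** Reversal of (q^(-n))_j, free of division: each factor 1 - q^(i-n) equals -q^(i-n) (1 -
    q^(n-i)). *)
Lemma poch_reflect (y : F) n j : y * q ^+ n = 1 -> (j <= n)%N ->
  poch y j * poch q (n - j) = (-1) ^+ j * q ^+ 'C(j, 2) * y ^+ j * poch q n.
Proof.
move=> yn; elim: j => [|j IHj] jn; first by rewrite subn0 poch0 !mulr1.
have := IHj (ltnW jn); rewrite -(subnSK jn) !pochS binS bin1 exprD !exprS => E.
have -> : 1 - y * q ^+ j = - (y * q ^+ j) * (1 - q * q ^+ (n - j.+1)).
  rewrite -exprS subnSK // mulrBr mulr1 mulNr -mulrA -exprD subnKC 1?ltnW // yn.
  by ring.
transitivity (- (y * q ^+ j) *
  (poch y j * (poch q (n - j.+1) * (1 - q * q ^+ (n - j.+1))))); first by ring.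
by rewrite E; ring.
Qed.

(* Here p = q^(-N) with N = r + n + 1, and a = q^(1 - 2N) = p^2 q. *)
Lemma conjugate_bailey (p : F) r n : p * q ^+ (r + n).+1 = 1 ->
  \sum_(j < n.+1) poch (p * q) (r + j) * poch q (r + j) * p ^+ (r + j) /
    (poch q j * poch (p ^+ 2 * q * q) (r + j + r)) =
  (1 - p ^+ 2 * q) / (1 - p) * p ^+ r * poch q r / poch (p ^+ 2 * q) r.
Proof.
move=> pq1; set a := p ^+ 2 * q.
have p2q1 : p ^+ 2 * q ^+ ((r + n).+1 + (r + n).+1) = 1.
  by rewrite exprD mulrACA pq1 mulr1.
have p1 : 1 - p != 0.
  by have := mul_exp_neq1 pq1 (ltn0Sn _); rewrite mulr1 subr_eq0 eq_sym.
have a1 : 1 - a != 0.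
  have := @mul_exp_neq1 _ _ 1 p2q1; rewrite addnS expr1 subr_eq0 eq_sym.
  exact.
have aP k : (k < r + r + n)%N -> a * q * q ^+ k != 1.
  move=> kn; have -> : a * q * q ^+ k = p ^+ 2 * q ^+ k.+2 by rewrite /a !exprS; ring.
  apply: mul_exp_neq1 p2q1 _.
  by rewrite addSn addnS !ltnS (leq_trans kn) // addnACA addnA leq_addr.
have aP0 k : (k < r + n)%N -> a * q ^+ k != 1.
  move=> kn; rewrite /a -(mulrA (p ^+ 2)) -exprS; apply: mul_exp_neq1 p2q1 _.
  by rewrite addSn ltnS (leq_trans kn) // leq_addr.
have V := q_vandermonde n (a * q ^+ r) (a * q * q ^+ (r + r)).
transitivity (poch (p * q) r * poch q r * p ^+ r * poch (a * q ^+ r) n /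
  poch (a * q) (r + r + n)); last first.
  (* Since a q^(r+n) = p, the product (a)_(2r+n+1) = (1 - a) (aq)_(2r+n) splits at r + n into
     (a)_(r+n) and (p)_(r+1). *)
  have -> : poch (a * q) (r + r + n) =
      poch a r * poch (a * q ^+ r) n * ((1 - p) * poch (p * q) r) / (1 - a).
    have ap : a * q ^+ (r + n) = p.
      by rewrite /a expr2 -!mulrA -exprS pq1 mulr1.
    apply: (mulIf a1); rewrite mulfVK // mulrC -!pochSl -pochD -[in RHS]ap -pochD.
    by rewrite addnS addnAC.
  have := poch_neq0 aP0; rewrite pochD mulf_eq0 negb_or => /andP[nz1 nz2].
  have nz3 : poch (p * q) r != 0.
    apply: poch_neq0 => k kr; rewrite -mulrA -exprS; apply: mul_exp_neq1 pq1 _.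
    by rewrite ltnS (leq_trans kr) // leq_addr.
  by field; rewrite nz1 nz2 nz3 p1 a1.
rewrite -V mulr_sumr mulr_suml; apply: eq_bigr => -[j /= jn] _.
rewrite ltnS in jn.
have -> : \prod_(i < j) (a * q ^+ r - a * q * q ^+ (r + r) * q ^+ i) =
    (a * q ^+ r) ^+ j * poch (q * q ^+ r) j.
  elim: j {jn} => [|j IHj]; first by rewrite big_ord0 poch0 mulr1.
  by rewrite big_ord_recr /= IHj pochS exprSr exprD; ring.
(* Here y = q^(-n) is the base left when (pq)_(r+j) is split at r, so [poch_reflect] turns (y)_j
   into the sign and the quotient (q)_n / (q)_(n-j) of the Vandermonde summand. Its y^j p^j comes
   from D = a q^r = y p. *)
pose y := p * q ^+ r.+1.
have yn : y * q ^+ n = 1 by rewrite -mulrA -exprD addSn.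
have pqr : p * q * q ^+ r = y by rewrite -mulrA -exprS.
have aqr : a * q ^+ r = y * p by rewrite /a /y (exprS q); ring.
have yE : poch y j = (-1) ^+ j * q ^+ 'C(j, 2) * y ^+ j * poch q n /
    poch q (n - j) by rewrite -poch_reflect // mulfK ?qfact_neq0.
have nz : poch (a * q) (r + r + n) != 0 by apply: poch_neq0.
have rrn : (r + r + n)%N = (r + r + j + (n - j))%N by rewrite -[RHS]addnA subnKC.
rewrite /gauss jn !(pochD _ r j) pqr aqr yE addnAC; move: nz.
rewrite rrn (pochD _ (r + r + j)) exprD mulrA mulf_eq0 negb_or => /andP[nz1 nz2].
rewrite [(y * p) ^+ j]exprMn exprD; have := (qfact_neq0 j, qfact_neq0 (n - j)).
by case=> nz3 nz4; field; rewrite nz1 nz2 nz3 nz4.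
Qed.

(** Once the sums are exchanged, the sum over l >= r is [conjugate_bailey]; its (q)_r / (a)_r
    cancels against [unit_alpha]. *)
Lemma bailey_chain_sum (p : F) m n : p * q ^+ n.+1 = 1 ->
  \sum_(l < n.+1) poch (p * q) l * p ^+ l *
    iter m (bailey_op (p ^+ 2 * q) n.+1) (fun k => (k == 0)%:R) l =
  \sum_(r < n.+1) (-1) ^+ r * q ^+ 'C(r, 2) *
    ((1 - p ^+ 2 * q * q ^+ (r + r)) / (1 - p)) * p ^+ r *
    ((p ^+ 2 * q) ^+ r * q ^+ (r ^ 2)) ^+ m.
Proof.
move=> pq1; set a := p ^+ 2 * q.
have p2q1 : p ^+ 2 * q ^+ (n.+1 + n.+1) = 1.
  by rewrite exprD mulrACA pq1 mulr1.
have aP k : (k < n + n)%N -> a * q * q ^+ k != 1.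
  move=> kn; have -> : a * q * q ^+ k = p ^+ 2 * q ^+ k.+2.
    by rewrite /a !exprS; ring.
  by apply: mul_exp_neq1 p2q1 _; rewrite addSn addnS !ltnS.
have aP0 k : (k < n.+1)%N -> a * q ^+ k != 1.
  move=> kn; rewrite /a -(mulrA (p ^+ 2)) -exprS; apply: mul_exp_neq1 p2q1 _.
  by rewrite addSn ltnS (leq_trans kn) // leq_addl.
have a1 : a != 1 by have := aP0 0 (ltn0Sn n); rewrite mulr1.
transitivity (\sum_(l < n.+1) \sum_(r < l.+1)
  (unit_alpha a r * (a ^+ r * q ^+ (r ^ 2)) ^+ m) *
  (poch (p * q) l * poch q l * p ^+ l /
     (poch q (l - r) * poch (a * q) (l + r)))).
  apply: eq_bigr => l _; rewrite bailey_chain // -1?ltnS // !mulr_sumr.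
  by apply: eq_bigr => r _; ring.
rewrite (sum_triangle _ (fun l r =>
  (unit_alpha a r * (a ^+ r * q ^+ (r ^ 2)) ^+ m) *
  (poch (p * q) l * poch q l * p ^+ l /
     (poch q (l - r) * poch (a * q) (l + r))))).
apply: eq_bigr => -[r /= rn] _; rewrite ltnS in rn.
rewrite -mulr_sumr subSn //.
under eq_bigr => j _ do rewrite addKn.
rewrite conjugate_bailey ?subnKC // -/a /unit_alpha.
have nza : 1 - a != 0 by rewrite subr_eq0 eq_sym.
have nzp : 1 - p != 0.
  by have := mul_exp_neq1 pq1 (ltn0Sn _); rewrite mulr1 subr_eq0 eq_sym.
have nzr : poch a r != 0.
  by apply: poch_neq0 => k kr; apply: aP0; rewrite ltnS (leq_trans (ltnW kr)).
by field; rewrite nza nzp nzr qfact_neq0.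
Qed.

End QSeries.

(** * Morton's sum for s = 2 as an alternating sum *)

(* Both sides are half of the alternating sum of h over the full interval
   [1 - N, N], on which h is odd about 1/2. *)
Lemma sum_odd_reflection (F : fieldType) N (h : int -> F) :
  2%:R != 0 :> F -> (forall e, h (1 - e) = - h e) ->
  \sum_(j < N) h (2 * (j : nat)%:Z - (N%:Z - 1)) =
  \sum_(n < N) (-1) ^+ n * h (n%:Z - (N%:Z - 1)).
Proof.
move=> nz2 hN; pose H n := (-1) ^+ n * h (n%:Z - (N%:Z - 1)).
(* The index n stands for e = n - (N - 1), so e -> 1 - e is n -> 2N - 1 - n. This changes the parity
   of n, and the sign cancels the oddness of h. *)
have half : \sum_(n < N + N) H n = 2%:R * \sum_(n < N) H n.
  rewrite big_split_ord /= [X in _ + X](reindex_inj rev_ord_inj) /=.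
  rewrite mulr_natl mulr2n; congr (_ + _); apply: eq_bigr => n _.
  have nN := ltn_ord n; rewrite /H.
  have -> : (N + (N - n.+1))%N%:Z - (N%:Z - 1) = 1 - (n%:Z - (N%:Z - 1)).
    by rewrite PoszD -subzn // intS; ring.
  rewrite hN -(signr_odd _ (N + _)) addnBA // oddB ?(leq_trans nN) ?leq_addr //.
  by rewrite addnn odd_double addFb oddS signrN signr_odd mulrNN.
(* Pair n = 2j with 2j + 1; the reflection carries the odd indices to the even ones. *)
have even_odd : \sum_(n < N + N) H n =
    2%:R * \sum_(j < N) h (2 * (j : nat)%:Z - (N%:Z - 1)).
  have -> : \sum_(n < N + N) H n = \sum_(j < N) (H j.*2 + H j.*2.+1).
    rewrite addnn; move: (N) => M; elim: M => [|M IHM]; first by rewrite !big_ord0.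
    by rewrite doubleS !big_ord_recr /= IHM addrA.
  rewrite big_split /= [X in _ + X](reindex_inj rev_ord_inj) /=.
  rewrite mulr_natl mulr2n -!big_split /=; apply: eq_bigr => j _.
  have jN := ltn_ord j.
  rewrite /H -!mul2n exprS !exprM sqrrN !expr1n mulr1 mul1r PoszM.
  have -> : (2 * (N - j.+1)).+1%:Z - (N%:Z - 1) =
      1 - (2 * (j : nat)%:Z - (N%:Z - 1)).
    by rewrite intS PoszM -subzn // intS; ring.
  by rewrite hN mulN1r opprK.
by apply: (mulfI nz2); rewrite -even_odd half.
Qed.

Lemma expr_bin2 (F : fieldType) (u : F) r :
  (u ^+ 4) ^+ 'C(r, 2) = u ^ (2 * (r%:Z * (r%:Z - 1))).
Proof.
rewrite -exprM exprnP; congr (_ ^ _).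
elim: r => [|r IHr] //; rewrite binS bin1 mulnDr PoszD IHr PoszM intS.
ring.
Qed.

Lemma torus_sum (F : fieldType) (u : F) m N :
  u != 0 -> 2%:R != 0 :> F -> (0 < N)%N ->
  let t := (2 * m + 1)%N%:Z in let p := (u ^+ 4) ^ (- N%:Z) in let q := u ^+ 4 in
  u ^ (2%:Z * t * (1 - N%:Z ^+ 2)) / (u ^ (2 * N%:Z) - u ^ (- (2 * N%:Z))) *
  \sum_(j < N)
     (let d : int := 2 * (j : nat)%:Z - (N%:Z - 1) in
     (u ^ (2%:Z * t * d ^+ 2 - 2 * (2%:Z + t) * d + 2)
      - u ^ (2%:Z * t * d ^+ 2 - 2 * (2%:Z - t) * d - 2))) =
  q ^ (m%:Z * (1 - N%:Z)) *
  \sum_(r < N) (-1) ^+ r * q ^+ 'C(r, 2) *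
    ((1 - p ^+ 2 * q * q ^+ (r + r)) / (1 - p)) * p ^+ r *
    ((p ^+ 2 * q) ^+ r * q ^+ (r ^ 2)) ^+ m.
Proof.
move=> u0 nz2 N0 t p q.
(* The first exponent in Morton's sum, and the second after d -> -d, share the part 2t(d^2 - d),
   which is even about 1/2; the remainders 2 - 4d and 4d - 2 are exchanged by d -> 1 - d. *)
pose h (e : int) := u ^ (2 * t * (e ^+ 2 - e)) * (u ^ (2 - 4 * e) - u ^ (4 * e - 2)).
have hN e : h (1 - e) = - h e.
  rewrite /h -[RHS]mulrN [in RHS]opprB; congr (_ * (_ - _)); first by congr (u ^ _); ring.
    by congr (u ^ _); ring.
  by congr (u ^ _); ring.
have -> : \sum_(j < N)
     (let d : int := 2 * (j : nat)%:Z - (N%:Z - 1) in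
     (u ^ (2%:Z * t * d ^+ 2 - 2 * (2%:Z + t) * d + 2)
      - u ^ (2%:Z * t * d ^+ 2 - 2 * (2%:Z - t) * d - 2))) =
   \sum_(j < N) h (2 * (j : nat)%:Z - (N%:Z - 1)).
  rewrite sumrB [X in _ - X](reindex_inj rev_ord_inj) -sumrB.
  apply: eq_bigr => j _; rewrite /= -subzn // intS /h [RHS]mulrBr -!expfzDr //.
  by congr (_ - _); congr (u ^ _); ring.
rewrite (sum_odd_reflection N nz2 hN) !mulr_sumr; apply: eq_bigr => r _.
have pE : p = u ^ (- (4 * N%:Z)) by rewrite /p exprnP exprz_exp mulrN.
have q2E : p ^+ 2 * q * q ^+ (r + r) = u ^ (- (8 * N%:Z) + 4 + 8 * r%:Z).
  rewrite pE /q -exprM !exprnP !exprz_exp -!expfzDr //; congr (u ^ _).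
  rewrite PoszM PoszD; ring.
have pqE : ((p ^+ 2 * q) ^+ r * q ^+ (r ^ 2)) ^+ m =
    u ^ (m%:Z * ((4 - 8 * N%:Z) * r%:Z + 4 * r%:Z ^+ 2)).
  rewrite pE /q -exprM !exprnP !exprz_exp -!expfzDr // exprz_exp -expfzDr // exprz_exp.
  congr (u ^ _); rewrite PoszM -mulnn PoszM; ring.
rewrite expr_bin2 q2E pqE /h.
have -> : u ^ (2 * N%:Z) - u ^ (- (2 * N%:Z)) = u ^ (2 * N%:Z) * (1 - p).
  rewrite pE mulrBr mulr1 -expfzDr //; congr (_ - u ^ _); ring.
set e := (r%:Z - (N%:Z - 1)).
have -> : u ^ (2 - 4 * e) - u ^ (4 * e - 2) =
    u ^ (2 - 4 * e) * (1 - u ^ (- (8 * N%:Z) + 4 + 8 * r%:Z)).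
  rewrite [RHS]mulrBr mulr1 -expfzDr //; congr (_ - u ^ _); rewrite /e; ring.
have -> : p ^+ r = u ^ (- (4 * N%:Z) * r%:Z) by rewrite pE exprnP exprz_exp.
have -> : q ^ (m%:Z * (1 - N%:Z)) = u ^ (4 * (m%:Z * (1 - N%:Z))).
  by rewrite /q exprnP exprz_exp.
set x := 1 - u ^ _; set y := 1 - p; set s := (-1) ^+ r.
rewrite invfM invr_expz.
(* With the sign and the quotient x / y set aside, each side is a single power of u, and only the
   exponents remain to be compared. *)
transitivity (s * (x / y) * (u ^ (2%:Z * t * (1 - N%:Z ^+ 2)) *
  u ^ (- (2 * N%:Z)) * u ^ (2 * t * (e ^+ 2 - e)) * u ^ (2 - 4 * e))).
  by ring.
transitivity (s * (x / y) * (u ^ (4 * (m%:Z * (1 - N%:Z))) *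
  u ^ (2 * (r%:Z * (r%:Z - 1))) * u ^ (- (4 * N%:Z) * r%:Z) *
  u ^ (m%:Z * ((4 - 8 * N%:Z) * r%:Z + 4 * r%:Z ^+ 2)))).
  rewrite -!expfzDr //; congr (_ * u ^ _).
  by rewrite /e /t PoszD PoszM; ring.
by ring.
Qed.

(** * The multiple sum over K as an iterated Bailey operator *)

Lemma u_neq0 : u != 0.
Proof. by rewrite tofrac_eq0 polyX_eq0. Qed.

Lemma q_neq0 : q != 0.
Proof. exact: expf_neq0 u_neq0. Qed.

Lemma u_exp_neq1 n : (0 < n)%N -> u ^+ n != 1.
Proof.
move=> n0; rewrite -tofracXn -tofrac1 tofrac_eq -subr_eq0.
by rewrite -size_poly_eq0 size_XnsubC.
Qed.

Lemma q_exp_neq1 n : (0 < n)%N -> q ^+ n != 1.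
Proof. by move=> n0; rewrite -exprM u_exp_neq1 // muln_gt0. Qed.

Lemma two_neq0 : 2%:R != 0 :> K.
Proof.
have -> : 2%:R = FracField.tofrac 2%:R :> K by rewrite rmorph_nat.
by rewrite tofrac_eq0 -polyC_natr polyC_eq0.
Qed.

Lemma big_tuple_cons (V : nmodType) (T : finType) n (f : n.+1.-tuple T -> V) :
  \sum_k f k = \sum_x \sum_(k : n.-tuple T) f [tuple of x :: k].
Proof.
rewrite pair_big /= (reindex (fun xk : T * n.-tuple T => [tuple of xk.1 :: xk.2])) //.
exists (fun k => (thead k, [tuple of behead k])) => [[x k]|k] _ /=.
  by congr (_, _); apply: val_inj.
by rewrite [RHS]tuple_eta.
Qed.

Lemma jones_term_cons N m (x : nat) (k : m.+1.-tuple nat) :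
  jones_term N [tuple of x :: k] =
  q ^ (x%:Z * (x%:Z + 1 - 2 * N%:Z)) * qbinom (thead k) x * jones_term N k.
Proof.
rewrite /jones_term /idx /= big_ltn // big_add1 /= /thead (tnth_nth 0%N) [RHS]mulrCA.
by congr (_ * (_ * _)); apply: eq_big_nat => -[].
Qed.

Lemma jones_weight N l :
  ((q ^ (- N%:Z)) ^+ 2 * q) ^+ l * q ^+ (l ^ 2) =
  q ^ (l%:Z * (l%:Z + 1 - 2 * N%:Z)).
Proof.
move: q_neq0; move: (q) => x x0.
rewrite !exprnP -{2}(expr1z x) !exprz_exp -!expfzDr // exprz_exp -expfzDr //.
by congr (_ ^ _); rewrite -mulnn PoszM; ring.
Qed.

(** The extra factor f at k_1 makes the induction work: summing out k_1 replaces f by its image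
    under [bailey_op], now a factor at k_2. *)
Lemma sum_jones_term N m (f : nat -> K) :
  \sum_(k : m.+1.-tuple 'I_N)
     jones_term N (map_tuple val k) * f (val (thead k)) =
  \sum_(l < N) qpoch (q ^ (1 - N%:Z)) l * q ^ (- (N%:Z * l%:Z)) *
    iter m (bailey_op q ((q ^ (- N%:Z)) ^+ 2 * q) N) f l.
Proof.
elim: m f => [|m IHm] f; rewrite big_tuple_cons.
  apply: eq_bigr => x _; rewrite (big_pred1 [tuple]) => [|k]; last first.
    by apply/esym/eqP; exact: tuple0.
  by rewrite /jones_term /idx /= big_geq // mulr1.
rewrite exchange_big /=.
under [RHS]eq_bigr => l _ do rewrite -iterS iterSr.
rewrite -IHm; apply: eq_bigr => k _; rewrite /bailey_op mulr_sumr.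
apply: eq_bigr => x _; rewrite jones_weight.
have -> : map_tuple val [tuple of x :: k] = [tuple of val x :: map_tuple val k].
  exact: val_inj.
rewrite jones_term_cons.
have -> : thead (map_tuple val k) = val (thead k) by rewrite /thead tnth_map.
have -> : thead [tuple of x :: k] = x by [].
rewrite -[gauss q _ _]/(qbinom _ _).
by rewrite [LHS]mulrAC mulrC.
Qed.

Lemma qpoch_vanish N k : (0 < N)%N -> (N <= k)%N ->
  qpoch (q ^ (1 - N%:Z)) k = 0.
Proof.
move=> N0 Nk; rewrite /qpoch (big_cat_nat _ (n := N.+1)) //=.
rewrite big_nat_recr //= exprnP -expfzDr ?q_neq0 //.
rewrite -[N in N.-1%:Z](prednK N0).
have -> : 1 - N%:Z + N.-1%:Z = 0 :> int by rewrite -{1}(prednK N0) intS; ring.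
by rewrite expr0z subrr mulr0 mul0r.
Qed.

(** * Support of the summand and conclusion *)

(** A nonzero Pochhammer factor gives k_m < N, and nonzero binomials force the ordering, which
    carries the bound to every entry. So the sum over ordered tuples may be taken over all tuples
    with entries below N. *)
Lemma jones_term_support N m (k : m.+1.-tuple nat) : (0 < N)%N ->
  jones_term N k != 0 -> sorted leq k /\ all (fun i => (i < N)%N) k.
Proof.
move=> N0; rewrite /jones_term !mulf_eq0 !negb_or -andbA => /and3P[kN _ kS].
have k_sorted : sorted leq k.
  apply/(sortedP 0%N) => i; rewrite size_tuple => im.
  move: kS; rewrite prodf_seq_neq0 => /allP/(_ i.+1).
  rewrite mem_index_iota im => /(_ isT) /=; rewrite mulf_eq0 negb_or => /andP[_].
  rewrite /idx /=; case: (leqP (nth 0%N k i) _) => // lt_k.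
  by rewrite -[qbinom _ _]/(gauss q _ _) gauss_small ?eqxx.
split=> //; apply/(all_nthP 0%N) => i; rewrite size_tuple => im.
apply: (@leq_ltn_trans (idx k m.+1)).
  by apply: (sorted_leq_nth leq_trans leqnn) => //; rewrite inE size_tuple.
by rewrite ltnNge; apply: contra kN => Nk; rewrite qpoch_vanish.
Qed.

Lemma bounded_tuple N m (k : m.-tuple nat) : all (fun i => (i < N)%N) k ->
  exists k' : m.-tuple 'I_N, k = map_tuple val k'.
Proof.
move/all_tnthP => kN; exists [tuple Ordinal (kN i) | i < m].
by apply: eq_from_tnth => i; rewrite tnth_map tnth_mktuple.
Qed.
Local Open Scope classical_set_scope.

(** The first Bailey step, from the unit pair to beta_n = 1/(q)_n; it supplies the constant factor f
    = 1 at k_1. *)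
Lemma bailey_op_delta0 (a : K) n k :
  bailey_op q a n.+1 (fun l => (l == 0)%:R) k = 1.
Proof.
rewrite /bailey_op big_ord_recl big1 => [|i _]; last by rewrite mulr0.
by rewrite !expr0 gauss0 ?mulr1 ?addr0 //; exact: q_exp_neq1.
Qed.

Theorem proposition9 (m N : nat) (hm : (1 <= m)%N) (hN : (1 <= N)%N) :
  [/\ forall k : nat, (N <= k)%N -> qpoch (q ^ (1 - N%:Z)) k = 0,
      finite_set [set k : m.-tuple nat | sorted leq k /\ jones_term N k <> 0]
    & jones_torus 2 (2 * m + 1) N =
      q ^ (m%:Z * (1 - N%:Z)) *
      \sum_(k \in [set k : m.-tuple nat | sorted leq k]) jones_term N k].

Proof.
case: m hm => [//|m] _.
pose r := [seq map_tuple val k | k : m.+1.-tuple 'I_N].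
have supp k : jones_term N k <> 0 -> sorted leq k /\ k \in r.
  move=> /eqP/(jones_term_support hN)[k_sorted /bounded_tuple[k' kE]].
  by split=> //; rewrite kE; apply: fintype.image_f.
split; first by move=> k; exact: qpoch_vanish.
  by apply: (sub_finite_set _ (finite_seq r)) => k [_ /supp[]].
have -> : \sum_(k \in [set k : m.+1.-tuple nat | sorted leq k]) jones_term N k =
    \sum_(k : m.+1.-tuple 'I_N) jones_term N (map_tuple val k).
  (* Unordered tuples contribute 0, so the ordering is dropped first; then the support is confined
     to the finite list [r]. *)
  rewrite (fsbig_widen _ setT) //; last first.
    by move=> k [_ kS]; apply/eqP; apply: contraT => /eqP/supp[].
  rewrite (fsbigE r) //; first last.
  - by move=> k _; apply: contraNeq => /eqP/supp[].
  - rewrite map_inj_uniq ?enum_uniq // => k k' /(congr1 val) /= /inj_map kk'.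
    by apply: val_inj; apply: kk' val_inj.
  rewrite big_mkcond big_map big_enum /=; apply: eq_bigr => k _.
  by rewrite in_setT.
case: N hN {supp r} => [//|n] _; set N := n.+1.
have pq : q ^ (1 - N%:Z) = q ^ (- N%:Z) * q by rewrite addrC expfzDr ?q_neq0.
have pq1 : q ^ (- N%:Z) * q ^+ n.+1 = 1.
  by rewrite exprnP -expfzDr ?q_neq0 // addNr expr0z.
transitivity (q ^ (m.+1%:Z * (1 - N%:Z)) * \sum_(l < N)
    poch q (q ^ (- N%:Z) * q) l * (q ^ (- N%:Z)) ^+ l *
    iter m.+1 (bailey_op q ((q ^ (- N%:Z)) ^+ 2 * q) N)
      (fun k => (k == 0)%:R) l).
  rewrite bailey_chain_sum //; last exact: q_exp_neq1.
  exact: (torus_sum _ u_neq0 two_neq0).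
congr (_ * _).
(* The factor 1 is written as a Bailey step applied to the delta, so that the m sums over inner
   indices and this step make m + 1 iterations. *)
under [RHS]eq_bigr => k _ do rewrite -[jones_term _ _]mulr1
  -(bailey_op_delta0 ((q ^ (- N%:Z)) ^+ 2 * q) n (val (thead k))).
rewrite sum_jones_term; apply: eq_bigr => l _.
by rewrite iterSr -pq exprnP exprz_exp mulNr.
Qed.
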